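(* Let $r$ and $d$ be two positive integers. Then $$\sum_{q=0}^{r-1}(-1)^q\binom{rd}{q}+\frac{(-1)^r}{d}\binom{rd}{r}=0.$$
   Context: $\binom{n}{q}=\frac{n!}{q!(n-q)!}$ denotes the binomial coefficient. *)

(* Defs.v *)
From mathcomp Require Import all_boot all_order all_algebra.

(* Main.v *)
(** Pascal's rule makes the alternating partial sum telescope to
    [(-1)^(r-1) 'C(rd - 1, r - 1)], and the absorption identity gives
    ['C(rd, r) = d 'C(rd - 1, r - 1)]. *)
Require Import Defs.
From mathcomp Require Import all_boot all_order all_algebra.
Import GRing.Theory.
Local Open Scope ring_scope.

(** Dividing 'C(rd, r) by d leaves 'C(rd - 1, r - 1), so the last term is exactly the telescoped sum
    with the opposite sign, and the two cancel. *)

Lemma sum_alternating_bin (R : pzRingType) (n k : nat) :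
  \sum_(0 <= q < k.+1) (-1) ^+ q * 'C(n.+1, q)%:R = (-1) ^+ k * 'C(n, k)%:R :> R.
Proof.
elim: k => [|k IHk]; first by rewrite big_nat1 !bin0.
by rewrite big_nat_recr //= IHk binS natrD mulrDr exprS !mulN1r !mulNr addrCA subrr addr0.
Qed.

(** Absorption at top index rd, with the common factor r cancelled. *)
Lemma bin_mul_diag (r d : nat) :
  (0 < r)%N -> 'C(r * d, r) = (d * 'C((r * d).-1, r.-1))%N.
Proof.
case: r => // r _; apply/eqP.
by rewrite -(eqn_pmul2l (ltn0Sn r)) mulnA mul_bin_diag.
Qed.

Theorem lemma4p10 (r d : nat) (hr : (0 < r)%N) (hd : (0 < d)%N) :
  \sum_(0 <= q < r) (-1) ^+ q * 'C(r * d, q)%:R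
    + (-1) ^+ r / d%:R * 'C(r * d, r)%:R = 0 :> rat.
Proof.
have d_neq0 : d%:R != 0 :> rat by rewrite Num.Theory.pnatr_eq0 -lt0n.
have rd_gt0 : (0 < r * d)%N by rewrite muln_gt0 hr.
rewrite (bin_mul_diag _ _ hr) natrM mulrA divfK //.
(* Only the summation bound and the exponent of the last sign get [r] as a successor: the first to
   match the telescoped sum, the second to split off a factor -1. *)
rewrite -(prednK rd_gt0) -{1 3}(prednK hr) sum_alternating_bin /=.
by rewrite exprS mulN1r mulNr subrr.
Qed.
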